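(* Let $\Omega$ be a class of unital separable $C^*$-algebras such that, for every $B\in\Omega$, the trace state space $T(B)$ is nonempty and compact and $B$ has uniform property $\Gamma$. Let $A$ be a simple infinite-dimensional separable unital stably finite $C^*$-algebra belonging to the class $\mathrm{WTA}\Omega$. Then $A$ has uniform property $\Gamma$.
   Context: Notation. For a $C^*$-algebra $A$ and positive elements $a,b\in A$, write $a\precsim b$ ($a$ is Cuntz subequivalent to $b$) if there is a sequence $(r_k)_{k\ge1}$ in $A$ with $\lim_{k\to\infty}\|r_kbr_k^*-a\|=0$. For $x\in A$, a subset $B\subseteq A$ and $\varepsilon>0$, write $x\in_\varepsilon B$ if there is $b\in B$ with $\|x-b\|<\varepsilon$. $T(A)$ denotes the space of tracial states of $A$. The class $\mathrm{WTA}\Omega$. Let $\Omega$ be a class of unital $C^*$-algebras. A simple unital $C^*$-algebra $A$ belongs to the class $\mathrm{WTA}\Omega$ if, for any $\varepsilon>0$, any finite subset $F\subseteq A$, and any nonzero element $a\ge 0$ of $A$, there exist a projection $p\in A$, an element $g\in A$ with $0\le g\le 1$, and a unital $C^*$-subalgebra $B$ of $A$ with $g\in B$, $1_B=p$ and $B\in\Omega$, such that (1) $(p-g)x\in_\varepsilon B$ and $x(p-g)\in_\varepsilon B$ for all $x\in F$; (2) $\|(p-g)x-x(p-g)\|<\varepsilon$ for all $x\in F$; (3) $1-(p-g)\precsim a$; (4) $\|(p-g)a(p-g)\|\ge\|a\|-\varepsilon$. Uniform property $\Gamma$. This is considered for a separable $C^*$-algebra $A$ with $T(A)$ nonempty and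 compact. It is used in the following (equivalent, local) form: $A$ has uniform property $\Gamma$ if for any finite subset $F\subseteq A$, any $\varepsilon>0$ and any $n\in\mathbb N$ (with $n\geq 1$) there exist pairwise orthogonal positive contractions $e_1,\dots,e_n\in A$ such that for all $i=1,\dots,n$ and all $a\in F$ one has $\|e_ia-ae_i\|<\varepsilon$ and $\sup_{\tau\in T(A)}|\tau(ae_i)-\tfrac1n\tau(a)|<\varepsilon$. *)

(* Defs.v *)
From HB Require Import structures.
From mathcomp Require Import all_boot all_order all_algebra.
From mathcomp Require Import all_classical all_reals all_analysis.
From mathcomp Require Import complex.

Set Implicit Arguments.
Unset Strict Implicit.
Unset Printing Implicit Defensive.

Import Order.TTheory GRing.Theory Num.Theory.
Import numFieldNormedType.Exports.

Local Open Scope classical_set_scope.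
Local Open Scope ring_scope.
Local Open Scope complex_scope.

(* A nonzero unital C*-algebra over R[i].  Norms take values in R[i], ordered by
   z <= w iff w - z is a nonnegative real.  The multiplication is a field of
   this record rather than inherited from GRing.Algebra, because a structure
   extending both GRing.Algebra and CompleteNormedModule would need a join that
   the hierarchy lacks; the algebra instance is declared just below. *)
Record cstarAlgType (R : realType) := CStarAlg {
  cstar_base : completeNormedModType R[i] ;
  cstar_one : cstar_base ;
  cstar_mul : cstar_base -> cstar_base -> cstar_base ;
  cstar_star : cstar_base -> cstar_base ;
  cstar_mulA : associative cstar_mul ;
  cstar_mul1l : left_id cstar_one cstar_mul ;
  cstar_mul1r : right_id cstar_one cstar_mul ;
  cstar_mulDl : left_distributive cstar_mul +%R ;
  cstar_mulDr : right_distributive cstar_mul +%R ;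
  cstar_one_neq0 : cstar_one != 0 ;
  cstar_scaleAl : forall (c : R[i]) x y,
    c *: cstar_mul x y = cstar_mul (c *: x) y ;
  cstar_scaleAr : forall (c : R[i]) x y,
    c *: cstar_mul x y = cstar_mul x (c *: y) ;
  cstar_starK : involutive cstar_star ;
  cstar_starD : {morph cstar_star : x y / x + y} ;
  cstar_starZ : forall (c : R[i]) x,
    cstar_star (c *: x) = Num.conj c *: cstar_star x ;
  cstar_starM : forall x y,
    cstar_star (cstar_mul x y) = cstar_mul (cstar_star y) (cstar_star x) ;
  cstar_normM : forall x y, `|cstar_mul x y| <= `|x| * `|y| ;
  cstar_normC : forall x, `|cstar_mul (cstar_star x) x| = `|x| ^+ 2
}.

Definition cstar_sort (R : realType) (A : cstarAlgType R) : Type :=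
  cstar_base A.
Coercion cstar_sort : cstarAlgType >-> Sortclass.

HB.instance Definition _ (R : realType) (A : cstarAlgType R) :=
  CompleteNormedModule.copy (cstar_sort A) (cstar_base A).
HB.instance Definition _ (R : realType) (A : cstarAlgType R) :=
  GRing.Zmodule_isNzRing.Build (cstar_sort A)
    (@cstar_mulA R A) (@cstar_mul1l R A) (@cstar_mul1r R A)
    (@cstar_mulDl R A) (@cstar_mulDr R A) (@cstar_one_neq0 R A).
HB.instance Definition _ (R : realType) (A : cstarAlgType R) :=
  GRing.Lmodule_isLalgebra.Build R[i] (cstar_sort A) (@cstar_scaleAl R A).
HB.instance Definition _ (R : realType) (A : cstarAlgType R) :=
  GRing.Lalgebra_isAlgebra.Build R[i] (cstar_sort A) (@cstar_scaleAr R A).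

Definition star (R : realType) (A : cstarAlgType R) (x : A) : A :=
  cstar_star x.

(* R[i] packaged so that its norm topology is found by inference. *)
Definition complex_numField (R : realType) : numFieldType := R[i].

Section CStarNotions.
Context {R : realType} {A : cstarAlgType R}.
Implicit Types (a b p x : A) (B F I : set A) (e : R).

Definition positive a : Prop := exists x, a = star x * x.

Definition projection p : Prop := star p = p /\ p * p = p.

Definition cuntz_sub a b : Prop :=
  exists r : nat -> A,
    (fun k => `|r k * b * star (r k) - a| : complex_numField R) @ \oo
      --> (0 : complex_numField R).

Definition approx_in x e B : Prop := exists2 b, B b & `|x - b| < e%:C.

(* For tau linear and positive on a unital algebra, tau 1 = 1 says that tau has
   norm one. *)
Definition tracial_state : set (A -> R[i]) :=
  [set tau | [/\ scalar tau,
                 forall x, 0 <= tau (star x * x),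
                 tau 1 = 1 &
                 forall x y, tau (x * y) = tau (y * x)]].

(* Weak-* compactness is compactness for pointwise convergence on A. *)
Definition trace_compact : Prop :=
  compact (tracial_state : set {ptws A -> complex_numField R}).

Definition separable_alg : Prop := exists2 D : set A, countable D & dense D.

Definition two_sided_ideal I : Prop :=
  [/\ I 0,
      forall x y, I x -> I y -> I (x + y),
      forall (c : R[i]) x, I x -> I (c *: x) &
      forall x y, I x -> I (y * x) /\ I (x * y)].

Definition simple_alg : Prop :=
  forall I, two_sided_ideal I -> closed I -> I = [set 0] \/ I = setT.

Definition infinite_dimensional : Prop :=
  forall (n : nat) (v : 'I_n -> A),
    exists x, forall c : 'I_n -> R[i], x <> \sum_(i < n) c i *: v i.

Definition mxstar (n : nat) (v : 'M[A]_n) : 'M[A]_n := map_mx (@star R A) v^T.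

(* Every M_n(A) is finite: a projection equivalent to the unit is the unit. *)
Definition stably_finite : Prop :=
  forall (n : nat) (v : 'M[A]_n),
    mxstar v *m v = 1%:M -> v *m mxstar v = 1%:M.

(* The supremum is taken in \bar R, so it is -oo when there is no tracial state. *)
Definition uniform_property_Gamma : Prop :=
  forall (F : set A) (e : R) (n : nat),
    finite_set F -> 0 < e -> (1 <= n)%N ->
    exists E : 'I_n -> A,
      [/\ forall i, positive (E i) /\ `|E i| <= 1,
          forall i j, i != j -> E i * E j = 0 &
          forall i a, F a ->
            `|E i * a - a * E i| < e%:C /\
            (ereal_sup [set (complex.Re `|tau (a * E i) - n%:R^-1 * tau a|)%:E
                       | tau in tracial_state] < e%:E)%E].

(* B is a C*-subalgebra of A whose unit is p (p need not be the unit of A). *)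
Definition cstar_subalgebra B p : Prop :=
  [/\ [/\ forall x y, B x -> B y -> B (x + y),
          forall (c : R[i]) x, B x -> B (c *: x),
          forall x y, B x -> B y -> B (x * y) &
          forall x, B x -> B (star x)],
      closed B,
      B p &
      forall x, B x -> p * x = x /\ x * p = x].

End CStarNotions.

Arguments trace_compact {R} A.
Arguments tracial_state {R} A.
Arguments separable_alg {R} A.
Arguments simple_alg {R} A.
Arguments infinite_dimensional {R} A.
Arguments stably_finite {R} A.
Arguments uniform_property_Gamma {R} A.

(* The C*-subalgebra B is *-isomorphic to a member of Omega; f does not map
   1 to 1 in general, so it is only linear, multiplicative and *-preserving. *)
Definition subalgebra_in_class (R : realType) (A : cstarAlgType R)
    (Omega : cstarAlgType R -> Prop) (B : set A) : Prop :=
  exists (D : cstarAlgType R) (f : {linear D -> A}),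
    [/\ Omega D,
        forall x y, f (x * y) = f x * f y,
        forall x, f (star x) = star (f x),
        injective f &
        range f = B].

Definition WTA (R : realType) (Omega : cstarAlgType R -> Prop)
    (A : cstarAlgType R) : Prop :=
  simple_alg A /\
  forall (e : R) (F : set A) (a : A),
    0 < e -> finite_set F -> positive a -> a <> 0 ->
    exists (p g : A) (B : set A),
      [/\ projection p,
          positive g /\ positive (1 - g),
          [/\ cstar_subalgebra B p, B g & subalgebra_in_class Omega B],
          forall x, F x -> approx_in ((p - g) * x) e B
                        /\ approx_in (x * (p - g)) e B &
          [/\ forall x, F x -> `|(p - g) * x - x * (p - g)| < e%:C,
              cuntz_sub (1 - (p - g)) a &
              `|(p - g) * a * (p - g)| >= `|a| - e%:C]].

(* Main.v *)
Require Import Defs.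
From mathcomp Require Import all_boot all_order all_algebra.
From mathcomp Require Import all_classical all_reals all_analysis.
From mathcomp Require Import complex ring lra.
From Stdlib Require Ncring Ncring_tac.

(** Fix a finite set [F] in [A], an integer [n] and a small [d > 0].  Suppose
that [a >= 0] is a nonzero element such that every contraction [c] that is
Cuntz-below [a] has [tau c <= d] for all traces [tau] of [A].  The approximation
property of [A], applied to [F], [d] and [a], gives a contraction [q = p - g >= 0]
in a subalgebra [B] of the class that almost commutes with [F], compresses [F]
approximately into [B], and satisfies [tau (1 - q) <= d].  Property Gamma of [B],
for [q] and for elements [b] of [B] close to the [q x], [x] in [F], gives
orthogonal positive contractions [e_i] in [B].  The elements [e_i q e_i] are
still exactly orthogonal, and they have the required properties:
- [e_i q e_i] almost commutes with [x], because up to small errors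
  [e q e x = e e q x = e e b = b e e = q x e e = x e q e]
  ([compressed_commutator]);
- [tau (x e_i q e_i)] is close to [tau (b e_i^2)], then to [tau (b e_i)], then
  to [tau b / n], then to [tau x / n] ([compressed_trace]).

The step from [e_i^2] to [e_i] is automatic.  If [S] is the sum of the [e_i], then
[tau ((1 - S)^2) >= 0] and orthogonality bound the sum of the
[tau (e_i - e_i^2)] by [tau (1 - S)], which property Gamma for [1] makes small
([trace_defect_le]).

The small element [a] comes from the same source ([WTA_small_trace]).  Some member
[D] of the class embeds into [A], by the approximation property for [1].  Property
Gamma of [D] for a large [N] gives [E >= 0] of trace about [1 / N] which is almost
a projection, so that [s = (2 E - 1)_+] is nonzero, and [b = min (2 E, 1)] is a
unit for [s] with [b^2 <= 4 E^2].  A contraction that is Cuntz-below [s^2] has trace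
at most [tau (b^2)], which is of the order of [1 / N] ([trace_cuntz_le]).

The restriction of a trace of [A] to a subalgebra is not normalized, so the
estimates are proved for all positive tracial functionals.

The facts on positive elements that these arguments use are derived from the
axioms of C*-algebras without spectral theory.  Positivity is encoded as
self-adjointness with [|t - a| <= t] for some [t], square roots come from a
convergent iteration, and the theorem of Kelley and Vaught that [x^* x] is positive
([psd_starM]) rests on a comparison of the powers of [1 + y^* y] and
[1 + y y^*]. *)

Set Implicit Arguments.
Unset Strict Implicit.
Unset Printing Implicit Defensive.

Import Order.TTheory GRing.Theory Num.Theory.
Import numFieldNormedType.Exports.

Local Open Scope classical_set_scope.
Local Open Scope ring_scope.
Local Open Scope complex_scope.

(** * Real-valued norms and the involution *)

Section Norm.
Context {R : realType}.

(** The norms take values in [R[i]]; their real parts lie in a totally ordered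
field. *)
Definition nrm (V : normedZmodType R[i]) (x : V) : R := complex.Re `|x|.

Section NormedZmodule.
Context {V : normedZmodType R[i]}.
Implicit Types x y : V.

Lemma nrmE x : `|x| = (nrm x)%:C.
Proof. by rewrite /nrm RRe_real // ger0_real. Qed.

Lemma nrm_ge0 x : 0 <= nrm x.
Proof. by rewrite -ler0c -nrmE. Qed.

Lemma nrm0 : nrm (0 : V) = 0.
Proof. by rewrite /nrm normr0. Qed.

Lemma nrm_eq0 x : nrm x <= 0 -> x = 0.
Proof.
move=> x0; apply/eqP; rewrite -normr_le0 nrmE.
by rewrite -(rmorph0 (real_complex R)) lecR.
Qed.

Lemma nrmN x : nrm (- x) = nrm x.
Proof. by rewrite /nrm normrN. Qed.

Lemma nrm_distC x y : nrm (x - y) = nrm (y - x).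
Proof. by rewrite -nrmN opprB. Qed.

Lemma nrmD x y : nrm (x + y) <= nrm x + nrm y.
Proof. by rewrite -lecR rmorphD /= -!nrmE ler_normD. Qed.

Lemma nrmB x y : nrm (x - y) <= nrm x + nrm y.
Proof. by rewrite -(nrmN y) nrmD. Qed.

Lemma nrm_distD y x z : nrm (x - z) <= nrm (x - y) + nrm (y - z).
Proof. by rewrite -(subrK y x) -addrA (le_trans (nrmD _ _)) // subrK. Qed.

Lemma nrm_le (x : V) t : (`|x| <= t%:C) = (nrm x <= t).
Proof. by rewrite nrmE lecR. Qed.

Lemma nrm_lt (x : V) t : (`|x| < t%:C) = (nrm x < t).
Proof. by rewrite nrmE ltcR. Qed.

End NormedZmodule.
End Norm.

Ltac ncring := Ncring_tac.non_commutative_ring.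

#[local] Instance cstar_ring_ops (R : realType) (A : cstarAlgType R) :
  @Ncring.Ring_ops A 0%R 1%R +%R *%R (fun x y => x - y)%R (@GRing.opp A) (@eq A)
  := {}.
#[local] Instance cstar_ring (R : realType) (A : cstarAlgType R) :
  Ncring.Ring (Ro := cstar_ring_ops A).
Proof.
split.
- exact: RelationClasses.eq_equivalence.
- by move=> x y <- z t <-.
- by move=> x y <- z t <-.
- by move=> x y <- z t <-.
- by move=> x y <-.
- exact: (@add0r A).
- exact: (@addrC A).
- exact: (@addrA A).
- exact: (@mul1r A).
- exact: (@mulr1 A).
- exact: (@mulrA A).
- exact: (@mulrDl A).
- by move=> x y z; exact: (@mulrDr A).
- by [].
- exact: (@subrr A).
Qed.

Section Algebra.
Context {R : realType} {A : cstarAlgType R}.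
Implicit Types (x y z a b c h : A) (s t : R).

Lemma starK x : star (star x) = x. Proof. exact: cstar_starK. Qed.
Lemma starM x y : star (x * y) = star y * star x. Proof. exact: cstar_starM. Qed.
Lemma starD x y : star (x + y) = star x + star y. Proof. exact: cstar_starD. Qed.
Lemma starZ (k : R[i]) x : star (k *: x) = Num.conj k *: star x.
Proof. exact: cstar_starZ. Qed.
Lemma starZr t x : star (t%:C *: x) = t%:C *: star x.
Proof. by rewrite starZ conj_Creal // complex_real. Qed.
Lemma star0 : star (0 : A) = 0.
Proof. by apply: (addrI (star 0)); rewrite -starD !addr0. Qed.
Lemma starN x : star (- x) = - star x.
Proof. by apply: (addrI (star x)); rewrite -starD !subrr star0. Qed.
Lemma starB x y : star (x - y) = star x - star y.
Proof. by rewrite starD starN. Qed.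
Lemma star1 : star (1 : A) = 1.
Proof. by rewrite -[RHS]starK -[in RHS](mulr1 (star 1)) starM starK mulr1. Qed.

Lemma nrmM x y : nrm (x * y) <= nrm x * nrm y.
Proof. by rewrite -lecR rmorphM /= -!nrmE; exact: cstar_normM. Qed.

Lemma nrmC x : nrm (star x * x) = nrm x ^+ 2.
Proof. by apply: complexI; rewrite rmorphXn /= -!nrmE; exact: cstar_normC. Qed.

Lemma nrm_star x : nrm (star x) = nrm x.
Proof.
suff le y : nrm y <= nrm (star y).
  by apply/eqP; rewrite eq_le le -{2}(starK x) le.
have [->|y0] := eqVneq (nrm y) 0; first exact: nrm_ge0.
have yp : 0 < nrm y by rewrite lt_def y0 nrm_ge0.
by rewrite -(ler_pM2r yp) -expr2 -nrmC nrmM.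
Qed.

Lemma nrmCV x : nrm (x * star x) = nrm x ^+ 2.
Proof. by rewrite -{1}(starK x) nrmC nrm_star. Qed.

Lemma nrm_sqr x : star x = x -> nrm (x * x) = nrm x ^+ 2.
Proof. by move=> xs; rewrite -{1}xs nrmC. Qed.

Lemma nrm1 : nrm (1 : A) = 1.
Proof.
have := nrmC 1; rewrite star1 mulr1 expr2 => /eqP.
rewrite -[X in X == _]mulr1 -subr_eq0 -mulrBr mulf_eq0 => /orP[/eqP n0|].
  by case/eqP: (oner_neq0 A); apply: nrm_eq0; rewrite n0.
by rewrite subr_eq0 => /eqP.
Qed.

Lemma nrmZ t x : nrm (t%:C *: x) = `|t| * nrm x.
Proof.
apply: complexI; rewrite -nrmE normrZ [`|x|]nrmE rmorphM /=; congr (_ * _).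
by rewrite normc_def /= expr0n addr0 sqrtr_sqr.
Qed.

Lemma nrmA t : nrm (t%:C%:A : A) = `|t|.
Proof. by rewrite nrmZ nrm1 mulr1. Qed.

Lemma starA t : star (t%:C%:A : A) = t%:C%:A.
Proof. by rewrite starZr star1. Qed.

(** A scalar majorant replaces the explicit Cauchy estimate for the square root
iteration, whose convergence need not be geometric. *)
Lemma cvg_dominated_increments (u : nat -> A) (y : nat -> R) M :
  (forall n, nrm (u n.+1 - u n) <= y n.+1 - y n) -> (forall n, y n <= M) ->
  exists l, forall e, 0 < e -> exists N, forall n, (N <= n)%N ->
    nrm (u n - l) < e.
Proof.
move=> uy yM.
have ynd : nondecreasing_seq y.
  by apply/nondecreasing_seqP => n; rewrite -subr_ge0 (le_trans _ (uy n)) ?nrm_ge0.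
have uyk n k : nrm (u (n + k)%N - u n) <= y (n + k)%N - y n.
  elim: k => [|k IH]; first by rewrite addn0 !subrr nrm0.
  rewrite addnS (le_trans (nrm_distD (u (n + k)%N) _ _)) //.
  by have := uy (n + k)%N; lra.
have /cvgrPdist_lt ycvg : y @ \oo --> sup (range y).
  apply: nondecreasing_cvgn => //; exists M => _ [n _ <-]; exact: yM.
have ule n : y n <= sup (range y).
  apply: sup_upper_bound; last by exists n.
  by split; [exists (y 0%N), 0%N|exists M => _ [m _ <-]].
have /cauchy_cvg ucvg : cauchy ((u : nat -> cstar_base A) @ \oo).
  apply: cauchy_exP => e e0.
  have eE : e = (complex.Re e)%:C by rewrite RRe_real // gtr0_real.
  have e0' : 0 < complex.Re e by rewrite -ltcR -eE.
  have [N _ HN] := ycvg _ e0'.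
  exists (u N); exists N => // n /= Nn.
  rewrite -ball_normE /= eE nrm_lt nrm_distC -(subnKC Nn).
  apply: le_lt_trans (uyk _ _) _.
  have := HN N (leqnn N); rewrite ger0_norm ?subr_ge0 //.
  by have := ule (N + (n - N))%N; lra.
exists (lim ((u : nat -> cstar_base A) @ \oo)) => e e0.
move/cvgrPdist_lt : ucvg => /(_ e%:C); rewrite ltcR => /(_ e0)[N _ HN].
by exists N => n Nn; rewrite nrm_distC -nrm_lt; apply: HN.
Qed.

End Algebra.

(** * Square roots *)

Lemma le0_eps (R : realType) (r K : R) :
  0 <= K -> (forall e, 0 < e -> r <= K * e) -> r <= 0.
Proof.
move=> K0 H; rewrite leNgt; apply/negP => r0.
have K1 : 0 < 2 * (K + 1) by lra.
have := H _ (divr_gt0 r0 K1); apply/negP; rewrite -ltNge mulrA ltr_pdivrMr //.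
by nra.
Qed.

Section SquareRoot.
Context {R : realType} {A : cstarAlgType R}.
Implicit Types (x y z a b c h r s v : A) (t : R).

Lemma scale_halfD x : (2^-1 : R)%:C *: x + (2^-1 : R)%:C *: x = x.
Proof. by rewrite -scalerDl -rmorphD /= (_ : 2^-1 + 2^-1 = 1) ?scale1r //; lra. Qed.

(** The iteration [u' = (h + u^2) / 2] converges to [1 - sqrt (1 - h)].  Its
increments are dominated by those of the same iteration for [h = 1] in the
real numbers, which is increasing and bounded by [1]. *)
Lemma sqrt_1B h : star h = h -> nrm h <= 1 ->
  exists r, [/\ star r = r, r * r = 1 - h, nrm (1 - r) <= 1 &
    forall z, z * h = h * z -> z * r = r * z].
Proof.
move=> hs h1.
pose u := fix u n := if n is m.+1 then (2^-1 : R)%:C *: (h + u m * u m) else 0.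
pose y := fix y n : R := if n is m.+1 then 2^-1 * (1 + y m * y m) else 0.
have uS n : u n.+1 = (2^-1 : R)%:C *: (h + u n * u n) by [].
have yS n : y n.+1 = 2^-1 * (1 + y n * y n) by [].
have u2 n : u n.+1 + u n.+1 = h + u n * u n by rewrite /= scale_halfD.
have us n : star (u n) = u n.
  by elim: n => [|n IH]; rewrite ?star0 //= starZr starD starM IH hs.
have uc n z : z * h = h * z -> z * u n = u n * z.
  move=> zh; elim: n => [|n IH]; first by rewrite mulr0 mul0r.
  rewrite /= -scalerAr -scalerAl mulrDr mulrDl zh; congr (_ *: (_ + _)).
  by rewrite mulrA IH -mulrA IH mulrA.
have ucc n m : u n * u m = u m * u n by apply: (uc m); rewrite (uc n h).
have y01 n : 0 <= y n <= 1.
  by elim: n => [|n /andP[y0 y1]] /=; apply/andP; split; nra.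
have uy n : nrm (u n) <= y n.
  elim: n => [|n IH] /=; first by rewrite nrm0.
  rewrite nrmZ ger0_norm ?invr_ge0 // ler_pM2l ?invr_gt0 //.
  rewrite (le_trans (nrmD _ _)) // lerD // (le_trans (nrmM _ _)) //.
  by rewrite ler_pM // nrm_ge0.
have duy n : nrm (u n.+1 - u n) <= y n.+1 - y n.
  elim: n => [|n IH].
    rewrite /= !mulr0 !subr0 !addr0 nrmZ ger0_norm ?invr_ge0 //.
    by rewrite mulr1; lra.
  have -> : u n.+2 - u n.+1 =
      (2^-1 : R)%:C *: ((u n.+1 - u n) * (u n.+1 + u n)).
    rewrite [u n.+2]uS [X in _ - X]uS -scalerBr; congr (_ *: _).
    have -> : (u n.+1 - u n) * (u n.+1 + u n) =
      u n.+1 * u n.+1 - u n * u n + (u n.+1 * u n - u n * u n.+1) by ncring.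
    by rewrite (ucc n n.+1) subrr addr0; ncring.
  have -> : y n.+2 - y n.+1 = 2^-1 * ((y n.+1 - y n) * (y n.+1 + y n)).
    by rewrite [y n.+2]yS [X in _ - X]yS; ring.
  rewrite nrmZ ger0_norm ?invr_ge0 // ler_pM2l ?invr_gt0 //.
  rewrite (le_trans (nrmM _ _)) // ler_pM ?nrm_ge0 //.
  by rewrite (le_trans (nrmD _ _)) // lerD.
have [l lP] : exists l, forall e, 0 < e -> exists N, forall n, (N <= n)%N ->
    nrm (u n - l) < e.
  by apply: (cvg_dominated_increments duy (M := 1)) => n; case/andP: (y01 n).
have l1 : nrm l <= 1.
  rewrite -subr_le0; apply: (@le0_eps _ _ 1) => // e e0.
  have [N /(_ N (leqnn N)) HN] := lP e e0.
  have := nrm_distD (u N) l 0; rewrite !subr0 nrm_distC => H.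
  by have := uy N; have /andP[_ yN] := y01 N; lra.
have l2 : l + l = h + l * l.
  apply/eqP; rewrite -subr_eq0; apply/eqP/nrm_eq0.
  apply: (@le0_eps _ _ 4) => // e e0.
  have [N HN] := lP e e0.
  have -> : l + l - (h + l * l) = (l - u N.+1) + (l - u N.+1) +
      (u N * (u N - l) + (u N - l) * l) + ((u N.+1 + u N.+1) - (h + u N * u N)).
    by ncring.
  rewrite u2 subrr addr0.
  have eN := HN N (leqnn N); have eN1 := HN N.+1 (leqnSn N).
  rewrite nrm_distC in eN1.
  have -> : 4 * e = (e + e) + (1 * e + e * 1) by ring.
  apply: (le_trans (nrmD _ _)); apply: lerD; apply: (le_trans (nrmD _ _)).
    by apply: lerD; apply: ltW.
  apply: lerD; apply: (le_trans (nrmM _ _)); rewrite ler_pM ?nrm_ge0 //.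
  - by rewrite (le_trans (uy N)) //; case/andP: (y01 N).
  - exact: ltW.
  - exact: ltW.
have ls : star l = l.
  apply/eqP; rewrite -subr_eq0; apply/eqP/nrm_eq0.
  apply: (@le0_eps _ _ 2) => // e e0.
  have [N /(_ N (leqnn N)) HN] := lP e e0.
  have := nrm_distD (star (u N)) (star l) l.
  by rewrite -starB nrm_star us [nrm (l - u N)]nrm_distC; lra.
have lc z : z * h = h * z -> z * l = l * z.
  move=> zh; apply/eqP; rewrite -subr_eq0; apply/eqP/nrm_eq0.
  apply: (@le0_eps _ _ (nrm z + nrm z)) => [|e e0].
    by rewrite addr_ge0 // nrm_ge0.
  have [N /(_ N (leqnn N)) HN] := lP e e0.
  have -> : z * l - l * z =
      z * (l - u N) + (u N - l) * z + (z * u N - u N * z) by ncring.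
  rewrite uc // subrr addr0 (le_trans (nrmD _ _)) // [leRHS]mulrDl.
  apply: lerD; apply: (le_trans (nrmM _ _)).
    by rewrite nrm_distC ler_pM ?nrm_ge0 // ltW.
  by rewrite mulrC ler_pM ?nrm_ge0 // ltW.
exists (1 - l); split.
- by rewrite starB star1 ls.
- have -> : (1 - l) * (1 - l) = 1 - (l + l) + l * l by ncring.
  by rewrite l2; ncring.
- by have -> : 1 - (1 - l) = l by ncring.
- by move=> z zh; rewrite mulrBr mulrBl mulr1 mul1r lc.
Qed.

(** The element [s + i r] is unitary, and [s] is its real part. *)
Lemma pythagoras_nrm_le1 s r : star s = s -> star r = r -> s * r = r * s ->
  s * s + r * r = 1 -> nrm s <= 1.
Proof.
move=> ss rs sr s1.
pose w := s + 'i%R *: r; pose w' := s - 'i%R *: r.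
have conj_i : Num.conj ('i%R : R[i]) = - 'i%R by rewrite conjCi.
have ws : star w = w' by rewrite starD starZ ss rs conj_i scaleNr.
have ii : 'i%R *: ('i%R *: (r * r)) = - (r * r).
  by rewrite scalerA -expr2 sqrCi scaleN1r.
have w1 : star w * w = 1.
  rewrite ws /w /w' mulrBl !mulrDr -!scalerAl -!scalerAr ii sr -s1.
  by ncring.
have nw : nrm w = 1.
  apply/eqP; rewrite -(@eqrXn2 _ 2) ?nrm_ge0 // -nrmC w1 nrm1 expr1n.
  exact: eqxx.
have : nrm (w + w') <= 1 + 1 by rewrite -ws -{2}nw -nw -{2}(nrm_star w) nrmD.
have -> : w + w' = (2 : R)%:C *: s.
  by rewrite /w /w' rmorphD /= rmorph1 scalerDl scale1r; ncring.
by rewrite nrmZ ger0_norm //; lra.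
Qed.

End SquareRoot.

(** * The positive cone *)

Section Positivity.
Context {R : realType} {A : cstarAlgType R}.
Implicit Types (x y z a b c h k p r s v : A) (t : R).

(** For self-adjoint [a], the condition [|t - a| <= t] says that the spectrum
of [a] lies between [0] and [2 t]; in this form the cone property is immediate. *)
Definition psd a : Prop :=
  star a = a /\ exists2 t, 0 < t & nrm (t%:C%:A - a) <= t.

Lemma psd_star a : psd a -> star a = a. Proof. by case. Qed.

Lemma scalerAD t t' : (t + t')%:C%:A = t%:C%:A + t'%:C%:A :> A.
Proof. by rewrite rmorphD /= scalerDl. Qed.

Lemma psdI t a : star a = a -> nrm (t%:C%:A - a) <= t -> psd a.
Proof.
move=> sa ta; have t0 : 0 <= t := le_trans (nrm_ge0 _) ta.
split=> //; exists (t + 1); first lra.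
have -> : (t + 1)%:C%:A - a = (t%:C%:A - a) + (1 : R)%:C%:A.
  by rewrite scalerAD; ncring.
by rewrite (le_trans (nrmD _ _)) // nrmA normr1 lerD2r.
Qed.

Lemma psdD a b : psd a -> psd b -> psd (a + b).
Proof.
move=> [sa [t t0 ta]] [sb [t' t'0 tb]].
apply: (@psdI (t + t')); first by rewrite starD sa sb.
have -> : (t + t')%:C%:A - (a + b) = (t%:C%:A - a) + (t'%:C%:A - b).
  by rewrite scalerAD; ncring.
by rewrite (le_trans (nrmD _ _)) // lerD.
Qed.

Lemma psdZ t a : 0 <= t -> psd a -> psd (t%:C *: a).
Proof.
move=> t0 [sa [t' t'0 ta]]; apply: (@psdI (t * t')); first by rewrite starZr sa.
by rewrite rmorphM /= -scalerA -scalerBr nrmZ ger0_norm // ler_wpM2l.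
Qed.

Lemma psdA t : 0 <= t -> psd t%:C%:A.
Proof. by move=> t0; apply: (@psdI t); rewrite ?starA // subrr nrm0. Qed.

Lemma psd1 : psd 1.
Proof. by rewrite -[1]scale1r; apply: (@psdA 1). Qed.

Lemma psd_subr_nrm t a : star a = a -> nrm a <= t -> psd (t%:C%:A - a).
Proof.
move=> sa at_; apply: (@psdI t); first by rewrite starB starA sa.
by have -> : t%:C%:A - (t%:C%:A - a) = a by ncring.
Qed.

(** The commutation property makes the root compatible with everything that
commutes with [a], in particular with another such root. *)
Lemma psd_sqrt a : psd a ->
  exists r, [/\ psd r, r * r = a & forall z, z * a = a * z -> z * r = r * z].
Proof.
move=> [sa [t t0 ta]].
have tV : 0 <= t^-1 by rewrite invr_ge0 ltW.
have tVt : t^-1 * t = 1 by rewrite mulVf // gt_eqF.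
have cZ : (t^-1)%:C *: t%:C%:A = 1 :> A.
  by rewrite scalerA -rmorphM /= tVt scale1r.
pose h := 1 - (t^-1)%:C *: a.
have hs : star h = h by rewrite starB star1 starZr sa.
have h1 : nrm h <= 1.
  rewrite /h -cZ -scalerBr nrmZ ger0_norm //.
  by rewrite -tVt ler_wpM2l.
have [r [rs rr r1 rc]] := sqrt_1B hs h1.
exists ((Num.sqrt t)%:C *: r); split.
- apply: psdZ; first exact: sqrtr_ge0.
  by apply: (@psdI 1); rewrite ?scale1r.
- rewrite -scalerAl -scalerAr scalerA -rmorphM /= -expr2 sqr_sqrtr ?ltW //.
  rewrite rr; have -> : 1 - h = (t^-1)%:C *: a by rewrite /h; ncring.
  by rewrite scalerA -rmorphM /= mulrC tVt scale1r.
- move=> z za; rewrite -scalerAl -scalerAr rc //.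
  by rewrite /h mulrBr mulrBl mulr1 mul1r -scalerAl -scalerAr za.
Qed.

(** For [|k| <= 1] let [r] be the square root of [1 - k^2].  Then
[r^2 + k^2 = 1], so [r] is a contraction, and so is [1 - k^2]. *)
Lemma psd_sqr k : star k = k -> psd (k * k).
Proof.
have unit_case x : star x = x -> nrm x <= 1 -> psd (x * x).
  move=> xs x1; have xxs : star (x * x) = x * x by rewrite starM xs.
  have xx1 : nrm (x * x) <= 1 by rewrite nrm_sqr // exprn_ile1 ?nrm_ge0.
  have [r [rs rr _ rc]] := sqrt_1B xxs xx1.
  have r1 : nrm r <= 1.
    apply: (@pythagoras_nrm_le1 _ _ r x) => //.
      by rewrite (rc x) // mulrA.
    by rewrite rr; ncring.
  apply: (@psdI 1) => //.
  by rewrite scale1r -rr nrm_sqr // exprn_ile1 ?nrm_ge0.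
move=> ks; pose t := nrm k + 1; have t0 : 0 < t by rewrite ltr_wpDl // nrm_ge0.
have -> : k * k = (t * t)%:C *: (((t^-1)%:C *: k) * ((t^-1)%:C *: k)).
  rewrite -scalerAl -scalerAr !scalerA -!rmorphM /=.
  have -> : t * t * t^-1 * t^-1 = 1 by field; rewrite gt_eqF.
  by rewrite scale1r.
apply: psdZ; first by rewrite mulr_ge0 ?ltW.
apply: unit_case; first by rewrite starZr ks.
rewrite nrmZ ger0_norm ?invr_ge0 ?(ltW t0) // mulrC ler_pdivrMr // mul1r /t.
by rewrite lerDl.
Qed.

(** The square roots of [a / t] and [1 - a / t] commute, so
[pythagoras_nrm_le1] applies to them. *)
Lemma psd_le_nrm t a : 0 < t -> psd a -> psd (t%:C%:A - a) -> nrm a <= t.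
Proof.
move=> t0 pa pb.
have [s [[ss _] sa sc]] := psd_sqrt pa; have [r [[rs _] rb rc]] := psd_sqrt pb.
have sr : s * r = r * s.
  apply: rc; rewrite mulrBr mulrBl -scalerAl -scalerAr mulr1 mul1r.
  by rewrite -sa mulrA.
pose q := (Num.sqrt t)^-1.
have qq : q * q = t^-1 by rewrite -invfM -expr2 sqr_sqrtr // ltW.
have q0 : 0 <= q by rewrite invr_ge0 sqrtr_ge0.
have : nrm (q%:C *: s) <= 1.
  apply: (@pythagoras_nrm_le1 _ _ _ (q%:C *: r)).
  - by rewrite starZr ss.
  - by rewrite starZr rs.
  - by rewrite -!scalerAl -!scalerAr sr.
  - rewrite -!scalerAl -!scalerAr sa rb !scalerA -rmorphM /= qq -scalerDr addrC.
    by rewrite subrK scalerA -rmorphM /= mulVf ?gt_eqF // scale1r.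
rewrite nrmZ ger0_norm // => s1.
rewrite -sa nrm_sqr //.
have : (q * nrm s) ^+ 2 <= 1 by rewrite exprn_ile1 // mulr_ge0 ?nrm_ge0.
by rewrite exprMn [q ^+ 2]expr2 qq mulrC ler_pdivrMr // mul1r.
Qed.

(** From [- a >= 0] one gets [a <= t] for every [t >= 0], in particular for
[t = |a| / 2]. *)
Lemma psd_anti a : psd a -> psd (- a) -> a = 0.
Proof.
move=> pa pN; apply: nrm_eq0; rewrite leNgt; apply/negP => a0.
have : nrm a <= nrm a / 2.
  apply: psd_le_nrm => //; first lra.
  by apply: psdD => //; apply: psdA; lra.
lra.
Qed.

Lemma psd_1B_projection p : projection p -> psd (1 - p).
Proof.
move=> [ps pp]; have -> : 1 - p = (1 - p) * (1 - p).
  have -> : (1 - p) * (1 - p) = 1 - p - p + p * p by ncring.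
  by rewrite pp; ncring.
by apply: psd_sqr; rewrite starB star1 ps.
Qed.

End Positivity.

(** * Elements of the form [x^* x] are positive *)

(** Bernoulli's inequality for the exponent [2^k], squared, makes [q^(2^(k+1))]
grow like the square of its exponent as soon as [q > 1]. *)
Lemma le1_of_linear_growth (R : realType) (q C : R) : 0 <= q ->
  (forall k, q ^+ (2 ^ k) <= 1 + C * (2 ^ k)%:R) -> q <= 1.
Proof.
move=> q0 qC; rewrite leNgt; apply/negP => q1.
pose s := q - 1; have s0 : 0 < s by rewrite subr_gt0.
have bern n : 1 + n%:R * s <= q ^+ n.
  elim: n => [|n IH]; first by rewrite mul0r addr0 expr0.
  have n0 : 0 <= n%:R :> R by [].
  rewrite exprS -natr1; have -> : q = 1 + s by rewrite /s; ring.
  have -> : 1 + s = q by rewrite /s; ring.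
  have qE : q = 1 + s by rewrite /s; ring.
  have : q * (1 + n%:R * s) <= q * q ^+ n by rewrite ler_wpM2l.
  apply: le_trans; rewrite qE; nra.
pose k := Num.truncn (2 * C / (s * s)).
have ks : 2 * C < k.+1%:R * (s * s).
  by rewrite -ltr_pdivrMr ?mulr_gt0 // truncnS_gt.
pose j : R := (2 ^ k.+1)%:R.
have jk : k.+1%:R <= j by rewrite ler_nat ltnW // ltn_expl.
have k0 : 0 < k.+1%:R :> R by [].
have := qC k.+2; rewrite expnS natrM mulnC exprM -/j.
have := bern (2 ^ k.+1)%N; rewrite -/j => b1 b2.
have b3 : (1 + j * s) * (1 + j * s) <= (q ^+ (2 ^ k.+1)) ^+ 2.
  by rewrite expr2; apply: ler_pM => //; nra.
have : j * (j * (s * s)) <= j * (2 * C) by nra.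
rewrite ler_pM2l; last lra.
have : k.+1%:R * (s * s) <= j * (s * s) by rewrite ler_wpM2r // mulr_ge0 // ltW.
lra.
Qed.

Section KelleyVaught.
Context {R : realType} {A : cstarAlgType R}.
Implicit Types (x y z a b c r s v w : A) (t : R).

Lemma starX x n : star x = x -> star (x ^+ n) = x ^+ n.
Proof.
by move=> xs; elim: n => [|n IH]; rewrite ?star1 // exprS starM IH xs -exprSr exprS.
Qed.

Lemma nrm_exp2 w k : star w = w -> nrm (w ^+ (2 ^ k)) = nrm w ^+ (2 ^ k).
Proof.
move=> ws; elim: k => [|k IH]; first by rewrite !expr1.
by rewrite expnS mulnC !exprM !expr2 nrm_sqr ?starX // IH expr2.
Qed.

(** With [u = 1 + y^* y] and [w = 1 + y y^*], the relation [y^* w = u y^*] gives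
[w^m = 1 + y b y^*] with [b = 1 + u + ... + u^(m-1)].  So the powers of [w] grow at
most linearly when [u] is a contraction, while [|w^m| = |w|^m] for the powers
[m] of [2]. *)
Lemma nrm_flip y : nrm (1 + star y * y) <= 1 -> nrm (1 + y * star y) <= 1.
Proof.
move=> u1; set u := 1 + star y * y in u1; set w := 1 + y * star y.
have ws : star w = w by rewrite starD star1 starM starK.
have powE m : exists2 b, nrm b <= m%:R & w ^+ m = 1 + y * b * star y.
  elim: m => [|m [b bm IH]].
    by exists 0; rewrite ?nrm0 // mulr0 mul0r addr0 expr0.
  exists (1 + b * u).
    rewrite (le_trans (nrmD _ _)) // nrm1 -nat1r lerD // (le_trans (nrmM _ _)) //.
    by rewrite -[leRHS]mulr1 ler_pM ?nrm_ge0.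
  by rewrite exprSr IH /w /u; ncring.
apply: (@le1_of_linear_growth _ _ (nrm y * nrm y)); first exact: nrm_ge0.
move=> k; rewrite -nrm_exp2 //; have [b bk ->] := powE (2 ^ k)%N.
rewrite (le_trans (nrmD _ _)) // nrm1 lerD // (le_trans (nrmM _ _)) // nrm_star.
rewrite mulrAC ler_pM ?nrm_ge0 // (le_trans (nrmM _ _)) //.
by rewrite ler_wpM2l ?nrm_ge0.
Qed.

Lemma psd_flip y : psd (- (star y * y)) -> psd (- (y * star y)).
Proof.
move=> [_ [t t0]].
pose q := (Num.sqrt t)^-1.
have qq : q * q = t^-1 by rewrite -invfM -expr2 sqr_sqrtr // ltW.
have tV : t * t^-1 = 1 by rewrite mulfV // gt_eqF.
have scale z : t%:C%:A + z = t%:C *: (1 + (t^-1)%:C *: z).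
  by rewrite scalerDr scalerA -rmorphM /= tV scale1r.
have yE : star (q%:C *: y) * (q%:C *: y) = (t^-1)%:C *: (star y * y).
  by rewrite starZr -scalerAl -scalerAr scalerA -rmorphM /= qq.
have yE' : (q%:C *: y) * star (q%:C *: y) = (t^-1)%:C *: (y * star y).
  by rewrite starZr -scalerAl -scalerAr scalerA -rmorphM /= qq.
rewrite opprK scale nrmZ ger0_norm ?(ltW t0) // -ler_pdivlMl // mulrC tV -yE.
move=> /nrm_flip; rewrite yE' => H.
apply: (@psdI _ _ t); first by rewrite starN starM starK.
by rewrite opprK scale nrmZ ger0_norm ?(ltW t0) // -ler_pdivlMl // mulrC tV.
Qed.

Lemma nilpotent8_eq0 v : star v = v -> v * v * (v * v) * (v * v * (v * v)) = 0 ->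
  v = 0.
Proof.
move=> vs v0; have := @nrm_exp2 v 3 vs.
have -> : v ^+ (2 ^ 3) = v * v * (v * v) * (v * v * (v * v)).
  by rewrite !exprSr expr0; ncring.
rewrite v0 nrm0 => /esym/eqP; rewrite expf_eq0 => /andP[_ /eqP n0].
by apply: nrm_eq0; rewrite n0.
Qed.

(** Kelley and Vaught's theorem.  With [a = x^* x] and [n = |a| - a], twice the
negative part of [a], the element [y = x n] satisfies [- y^* y >= 0]; hence also
[- y y^* >= 0], whereas [y^* y + y y^* >= 0]. *)
Theorem psd_starM x : psd (star x * x).
Proof.
set a := star x * x; have sa : star a = a by rewrite starM starK.
have [r [pr rr rc]] := psd_sqrt (psd_sqr sa).
have ra : a * r = r * a by apply: rc; rewrite mulrA.
have [s [ps ss sc]] := psd_sqrt pr.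
have rs := psd_star pr; have sS := psd_star ps.
pose n := r - a; have ns : star n = n by rewrite starB rs sa.
have nr : n * r = r * n by rewrite /n mulrBl mulrBr ra.
have sn : n * s = s * n by apply: sc.
have an : a * n = - (r * n) by rewrite /n !mulrBr rr ra; ncring.
have nn : n * n = r * n + r * n.
  have -> : n * n = r * n - a * n by rewrite /n; ncring.
  by rewrite an opprK.
pose y := x * n.
have yE : star y * y = - (s * n * (s * n)).
  have -> : star y * y = n * (a * n).
    by rewrite starM ns /y /a; ncring.
  rewrite an -ss mulrN; have -> : n * (s * s * n) = n * s * (s * n) by ncring.
  by rewrite sn.
have snS : star (s * n) = s * n by rewrite starM ns sS sn.
have py : psd (- (star y * y)) by rewrite yE opprK; exact: psd_sqr.
have y0 : star y * y = 0.
  apply: psd_anti => //.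
  have -> : star y * y = (star y * y + y * star y) + (- (y * star y)) by ncring.
  apply: psdD; last exact: psd_flip.
  pose d := 'i%R *: (y - star y).
  have dS : star d = d.
    by rewrite /d starZ starB starK conjCi scaleNr -scalerN opprB.
  have dd : d * d = - ((y - star y) * (y - star y)).
    by rewrite -scalerAl -scalerAr scalerA -expr2 sqrCi scaleN1r.
  have half (q : A) : psd (q + q) -> psd q.
    move=> pq; rewrite -(scale_halfD q) -scalerDr.
    by apply: psdZ; rewrite ?invr_ge0.
  have : psd ((y + star y) * (y + star y) + d * d).
    apply: psdD; last exact: (psd_sqr dS).
    by apply: psd_sqr; rewrite starD starK addrC.
  have -> : (y + star y) * (y + star y) + d * d =
    (star y * y + y * star y) + (star y * y + y * star y) by rewrite dd; ncring.
  exact: half.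
have n0 : n = 0.
  apply: nilpotent8_eq0 => //.
  have nrn : n * (r * n) = 0.
    apply/eqP; rewrite -oppr_eq0 -mulrN -an; apply/eqP.
    by rewrite -[RHS]y0 starM ns /y /a; ncring.
  have n3 : n * (n * n) = 0 by rewrite nn mulrDr nrn addr0.
  have -> : n * n * (n * n) * (n * n * (n * n)) =
    n * (n * n) * (n * (n * n)) * (n * n) by ncring.
  by rewrite n3 !mul0r.
by have -> : a = r by apply/esym/eqP; rewrite -subr_eq0 -/n n0.
Qed.

Lemma positive_psd a : positive a -> psd a.
Proof. by move=> [x ->]; exact: psd_starM. Qed.

Lemma psd_positive a : psd a -> positive a.
Proof. by move=> /psd_sqrt[r [/psd_star rs <- _]]; exists r; rewrite rs. Qed.

Lemma psd_conj z a : psd a -> psd (star z * a * z).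
Proof.
move=> /psd_sqrt[r [/psd_star rs <- _]].
have -> : star z * (r * r) * z = star (r * z) * (r * z).
  by rewrite starM rs; ncring.
exact: psd_starM.
Qed.

Lemma psd_conj_sa v a : star v = v -> psd a -> psd (v * a * v).
Proof. by move=> vs pa; rewrite -{1}vs; exact: psd_conj. Qed.

End KelleyVaught.

(** * Positive and negative parts *)

Section JordanDecomposition.
Context {R : realType} {A : cstarAlgType R}.
Implicit Types (x y z a b c r s v w : A) (t : R).

(** With [n = r - v] one has [n^2 = 2 r n], so [n^3 = 2 n r n >= 0].  The same
computation for [m = |n| - n] gives [m^3 >= 0], while [m n = - m^2 / 2] turns
[m n^3 m >= 0] into [- m^5 >= 0].  Hence [m = 0]. *)
Lemma psd_abs_sub r v : psd r -> star v = v -> v * r = r * v -> r * r = v * v ->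
  psd (r - v).
Proof.
have calc r' v' : v' * r' = r' * v' -> r' * r' = v' * v' ->
    v' * (r' - v') = - (r' * (r' - v')) /\
    (r' - v') * (r' - v') = r' * (r' - v') + r' * (r' - v').
  move=> vr rr; have E : v' * (r' - v') = - (r' * (r' - v')).
    by rewrite !mulrBr vr rr; ncring.
  split=> //.
  have -> : (r' - v') * (r' - v') = r' * (r' - v') - v' * (r' - v') by ncring.
  by rewrite E opprK.
move=> pr vs vr rr.
have [_ nn] := calc r v vr rr.
set n := r - v in nn *.
have ns : star n = n by rewrite /n starB vs psd_star.
have n3 : psd (n * n * n).
  rewrite -mulrA nn mulrDr mulrA; apply: psdD; exact: psd_conj_sa.
clearbody n; clear nn.
have [r' [pr' rr' rc']] := psd_sqrt (psd_sqr ns).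
have nr' : n * r' = r' * n by apply: rc'; rewrite mulrA.
have [nm mm] := calc r' n nr' rr'.
set m := r' - n in nm mm.
have ms : star m = m by rewrite /m starB ns psd_star.
have mn : m * n = n * m by rewrite /m mulrBl mulrBr nr'.
have nm2 : n * m + n * m = - (m * m) by rewrite mm nm opprD.
have p5 : psd (m * m * m * m * m).
  have -> : m * m * m * m * m = m * (m * (m * m) * m) by ncring.
  rewrite mm; have -> : m * (m * (r' * m + r' * m) * m) =
    m * (m * r' * m) * m + m * (m * r' * m) * m by ncring.
  by apply: psdD; apply: psd_conj_sa => //; apply: psd_conj_sa.
have p5N : psd (- (m * m * m * m * m)).
  pose q := m * (n * n * n) * m.
  have pq : psd q by exact: psd_conj_sa.
  have qE : q + q + q + q = m * m * n * (m * m).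
    have -> : q + q + q + q = (m * n + m * n) * n * (n * m + n * m).
      by rewrite /q; ncring.
    by rewrite mn nm2; ncring.
  have -> : - (m * m * m * m * m) = (q + q + q + q) + (q + q + q + q).
    rewrite qE; have -> : m * m * n * (m * m) + m * m * n * (m * m) =
      m * m * (n * m + n * m) * m by ncring.
    by rewrite nm2; ncring.
  by apply: psdD; do !apply: psdD.
have m0 : m = 0.
  apply: nilpotent8_eq0 => //.
  have -> : m * m * (m * m) * (m * m * (m * m)) = m * m * m * m * m * (m * m * m).
    by ncring.
  by rewrite (psd_anti p5 p5N) mul0r.
by have -> : n = r' by apply/esym/eqP; rewrite -subr_eq0 -/m m0.
Qed.

Lemma pos_neg_parts v : star v = v -> exists p n,
  [/\ psd p, psd n, v = p - n, p * n = 0 & n * p = 0].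
Proof.
move=> vs; have [r [pr rr rc]] := psd_sqrt (psd_sqr vs).
have vr : v * r = r * v by apply: rc; rewrite mulrA.
have pn : psd (r - v) by exact: psd_abs_sub.
have pp : psd (r + v).
  rewrite -(opprK v); apply: psd_abs_sub; rewrite ?starN ?vs //.
    by rewrite mulNr mulrN vr.
  by rewrite rr; ncring.
exists ((2^-1 : R)%:C *: (r + v)), ((2^-1 : R)%:C *: (r - v)); split.
- by apply: psdZ; rewrite ?invr_ge0.
- by apply: psdZ; rewrite ?invr_ge0.
- rewrite -scalerBr; have -> : r + v - (r - v) = v + v by ncring.
  by rewrite scalerDr scale_halfD.
- rewrite -scalerAl -scalerAr; have -> : (r + v) * (r - v) = 0.
    have -> : (r + v) * (r - v) = r * r - v * v + (v * r - r * v) by ncring.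
    by rewrite rr vr !subrr addr0.
  by rewrite !scaler0.
- rewrite -scalerAl -scalerAr; have -> : (r - v) * (r + v) = 0.
    have -> : (r - v) * (r + v) = r * r - v * v - (v * r - r * v) by ncring.
    by rewrite rr vr !subrr.
  by rewrite !scaler0.
Qed.

End JordanDecomposition.

(** * Homomorphisms that preserve the involution *)

Section Homomorphism.
Context {R : realType} {D A : cstarAlgType R} (f : {linear D -> A}).
Hypotheses (fM : forall x y, f (x * y) = f x * f y)
  (fS : forall x, f (star x) = star (f x)).

Lemma psd_hom a : psd a -> psd (f a).
Proof.
move=> /psd_sqrt[r [/psd_star rs <- _]]; rewrite fM.
by apply: psd_sqr; rewrite -fS rs.
Qed.

Lemma projection_hom1 : projection (f 1).
Proof. by split; rewrite -?fS ?star1 // -fM mulr1. Qed.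

(** [|x|^2 - x^* x >= 0] is preserved, up to replacing the unit by a projection. *)
Lemma nrm_hom x : nrm (f x) <= nrm x.
Proof.
have [x0|x0] := leP (nrm x) 0.
  by rewrite (nrm_eq0 x0) linear0 !nrm0.
have xx : psd ((nrm x ^+ 2)%:C%:A - star x * x).
  by apply: psd_subr_nrm; rewrite ?nrmC // starM starK.
have : nrm (star (f x) * f x) <= nrm x ^+ 2.
  apply: psd_le_nrm; rewrite ?exprn_gt0 //; first exact: psd_starM.
  have -> : (nrm x ^+ 2)%:C%:A - star (f x) * f x =
     (nrm x ^+ 2)%:C *: (1 - f 1) + f ((nrm x ^+ 2)%:C%:A - star x * x).
    by rewrite (linearB f) [f (_ *: _)]linearZ /= fM fS scalerBr; ncring.
  apply: psdD; last exact: psd_hom.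
  apply: psdZ; first by rewrite exprn_ge0 ?nrm_ge0.
  exact: psd_1B_projection projection_hom1.
by rewrite nrmC ler_pXn2r // nnegrE nrm_ge0.
Qed.

End Homomorphism.

(** * Positive tracial functionals *)

Section Traces.
Context {R : realType}.

Lemma nrmcM (u v : R[i]) : nrm (u * v) = nrm u * nrm v.
Proof. by apply: complexI; rewrite rmorphM /= -!nrmE normrM. Qed.

Lemma nrm_real (t : R) : nrm (t%:C : R[i]) = `|t|.
Proof. by apply: complexI; rewrite -nrmE normc_def /= expr0n addr0 sqrtr_sqr. Qed.

Lemma Re_le_nrm (u : R[i]) : complex.Re u <= nrm u.
Proof.
rewrite -lecR -nrmE normc_def lecR; apply: le_trans (ler_norm _) _.
by rewrite -sqrtr_sqr ler_wsqrtr // lerDl sqr_ge0.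
Qed.

Lemma ReZ (t : R) (u : R[i]) : complex.Re (t%:C * u) = t * complex.Re u.
Proof. by case: u => u v /=; rewrite mul0r subr0. Qed.

Lemma natVC n : n%:R^-1 = (n%:R^-1 : R)%:C.
Proof. by rewrite fmorphV rmorph_nat. Qed.

Section Functional.
Context {A : cstarAlgType R}.
Implicit Types (x y z a b c r s v w : A) (t : R).

(** Tracial states without the normalization: this class contains the
restrictions of the traces of an algebra to its non-unital subalgebras. *)
Definition pos_trace (phi : A -> R[i]) : Prop :=
  [/\ scalar phi, forall x, 0 <= phi (star x * x) &
      forall x y, phi (x * y) = phi (y * x)].

Lemma tracial_state_pos_trace tau : tracial_state A tau -> pos_trace tau.
Proof. by case. Qed.

Context {phi : A -> R[i]} (trphi : pos_trace phi).
Local Notation rho x := (complex.Re (phi x)).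

Lemma traceP (k : R[i]) x y : phi (k *: x + y) = k * phi x + phi y.
Proof. by case: trphi => + _ _; apply. Qed.

Lemma traceC x y : phi (x * y) = phi (y * x).
Proof. by case: trphi => _ _; apply. Qed.

Lemma trace0 : phi 0 = 0.
Proof. by have := traceP (-1) 0 0; rewrite scaler0 addr0 mulN1r addNr. Qed.

Lemma traceD x y : phi (x + y) = phi x + phi y.
Proof. by have := traceP 1 x y; rewrite scale1r mul1r. Qed.

Lemma traceZ (k : R[i]) x : phi (k *: x) = k * phi x.
Proof. by have := traceP k x 0; rewrite trace0 !addr0. Qed.

Lemma traceB x y : phi (x - y) = phi x - phi y.
Proof. by rewrite traceD -scaleN1r traceZ mulN1r. Qed.

Lemma trace_sum n (E : 'I_n -> A) : phi (\sum_i E i) = \sum_i phi (E i).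
Proof. by elim/big_rec2: _ => [|i u v _ <-]; rewrite ?trace0 ?traceD. Qed.

Lemma trace_psd a : psd a -> 0 <= phi a.
Proof.
by move=> /psd_positive[x ->]; case: trphi => _ + _; apply.
Qed.

Lemma Re_trace_psd a : psd a -> 0 <= rho a.
Proof. by move=> /trace_psd; rewrite lecE => /andP[]. Qed.

Lemma Im_trace_psd a : psd a -> complex.Im (phi a) = 0.
Proof. by move=> /trace_psd/ger0_Im. Qed.

Lemma trace_le a b : psd (b - a) -> rho a <= rho b.
Proof. by move=> /Re_trace_psd; rewrite traceB raddfB subr_ge0. Qed.

Lemma trace_Zr t x : rho (t%:C *: x) = t * rho x.
Proof. by rewrite traceZ ReZ. Qed.

Lemma trace_mul_sa x c : star x = x -> psd c -> nrm (phi (x * c)) <= nrm x * rho c.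
Proof.
move=> xs pc; have [s [/psd_star ss sc _]] := psd_sqrt pc.
have -> : phi (x * c) = phi (s * x * s) by rewrite -sc mulrA traceC mulrA.
have key y : star y = y -> nrm y <= nrm x ->
    psd ((nrm x)%:C *: c - s * y * s).
  move=> ys yx.
  have -> : (nrm x)%:C *: c - s * y * s = s * ((nrm x)%:C%:A - y) * s.
    by rewrite mulrBr mulrBl -scalerAr mulr1 -scalerAl sc.
  by apply: psd_conj_sa => //; apply: psd_subr_nrm.
have p1 := key x xs (lexx _).
have p2 : psd ((nrm x)%:C *: c + s * x * s).
  have -> : (nrm x)%:C *: c + s * x * s = (nrm x)%:C *: c - s * (- x) * s.
    by ncring.
  by apply: key; rewrite ?starN ?xs ?nrmN.
have := Re_trace_psd p1; rewrite traceB raddfB /= trace_Zr => r1.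
have := Re_trace_psd p2; rewrite traceD raddfD /= trace_Zr => r2.
have i0 : complex.Im (phi (s * x * s)) = 0.
  have := Im_trace_psd p1; rewrite traceB raddfB /= traceZ.
  have := Im_trace_psd pc; case: (phi c) => u v /= ->.
  by rewrite mulr0 mul0r addr0 sub0r => /eqP; rewrite oppr_eq0 => /eqP.
rewrite -(RRe_real (x := phi (s * x * s))); last first.
  by case: (phi _) i0 => a b /= ->; rewrite complex_real.
by rewrite nrm_real ler_norml; apply/andP; split; lra.
Qed.

(** The factor [2] comes from treating the real and imaginary parts of [x]
separately. *)
Lemma trace_mul_psd x c : psd c -> nrm (phi (x * c)) <= 2 * nrm x * rho c.
Proof.
move=> pc; have rc := Re_trace_psd pc.
pose d := 'i%R *: (x - star x).
have ds : star d = d.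
  by rewrite /d starZ starB starK conjCi scaleNr -scalerN opprB.
have es : star (x + star x) = x + star x by rewrite starD starK addrC.
have h1 : nrm (phi ((x + star x) * c)) <= 2 * nrm x * rho c.
  apply: le_trans (trace_mul_sa es pc) _; apply: ler_wpM2r => //.
  by rewrite (le_trans (nrmD _ _)) // nrm_star; lra.
have ni z : nrm ('i%R *: z) = nrm z.
  by apply: complexI; rewrite -!nrmE normrZ normCi mul1r.
have h2 : nrm (phi ((x - star x) * c)) <= 2 * nrm x * rho c.
  have -> : nrm (phi ((x - star x) * c)) = nrm (phi (d * c)).
    rewrite -scalerAl traceZ nrmcM.
    by have -> : nrm ('i%R : R[i]) = 1; rewrite ?mul1r //= /nrm normCi.
  apply: le_trans (trace_mul_sa ds pc) _; apply: ler_wpM2r => //.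
  by rewrite ni (le_trans (nrmB _ _)) // nrm_star; lra.
have E : phi ((x + star x) * c) + phi ((x - star x) * c) =
    (2 : R)%:C * phi (x * c).
  rewrite -traceD; have -> : (x + star x) * c + (x - star x) * c = x * c + x * c.
    by ncring.
  by rewrite traceD rmorphD rmorph1 mulrDl mul1r.
have := nrmD (phi ((x + star x) * c)) (phi ((x - star x) * c)).
rewrite E nrmcM nrm_real ger0_norm //; lra.
Qed.

Lemma trace_nrm x : nrm (phi x) <= 2 * nrm x * rho 1.
Proof. by rewrite -{1}(mulr1 x) trace_mul_psd //; exact: psd1. Qed.

(** A positive trace is a multiple of a tracial state, unless it vanishes at [1]
and is therefore zero. *)
Lemma trace_bound_of_states x C : 0 <= C ->
  (forall sigma, tracial_state A sigma -> nrm (sigma x) <= C) ->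
  nrm (phi x) <= C * rho 1.
Proof.
move=> C0 H; have p1 := Re_trace_psd psd1.
have [t0|t0] := leP (rho 1) 0.
  have e0 : rho 1 = 0 by apply/eqP; rewrite eq_le t0 p1.
  by have := trace_nrm x; rewrite e0 !mulr0.
have e1 : phi 1 = (rho 1)%:C.
  by have := Im_trace_psd psd1; case: (phi 1) => u v /= ->.
have tV : 0 < (rho 1)^-1 by rewrite invr_gt0.
pose sigma (z : A) : R[i] := ((rho 1)^-1)%:C * phi z.
have : tracial_state A sigma.
  split.
  - by move=> k u v; rewrite /sigma traceP mulrDr !mulrA [_ * k]mulrC.
  - move=> u; rewrite /sigma mulr_ge0 //; first by rewrite ler0c ltW.
    exact/trace_psd/psd_starM.
  - by rewrite /sigma e1 -rmorphM /= mulVf // gt_eqF.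
  - by move=> u v; rewrite /sigma traceC.
move/H; rewrite /sigma nrmcM nrm_real gtr0_norm // mulrC.
by rewrite ler_pdivrMr.
Qed.

Lemma psd_defect a : psd a -> nrm a <= 1 -> psd (a - a * a).
Proof.
move=> pa a1; have [s [/psd_star ss sa _]] := psd_sqrt pa.
have -> : a - a * a = s * ((1 : R)%:C%:A - a) * s.
  by rewrite scale1r -sa; ncring.
by apply: psd_conj_sa => //; apply: psd_subr_nrm => //; exact: psd_star.
Qed.

(** Orthogonal contractions whose sum has almost full trace are almost
projections for the trace: with [S] their sum, [phi ((1 - S)^2) >= 0]. *)
Lemma trace_defect_le n (E : 'I_n -> A) :
  (forall i, psd (E i) /\ nrm (E i) <= 1) ->
  (forall i j, i != j -> E i * E j = 0) ->
  forall i, rho (E i - E i * E i) <= rho 1 - \sum_j rho (E j).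
Proof.
move=> Epsd Eorth i; pose S := \sum_j E j.
have Ss : star S = S.
  rewrite /S; elim/big_rec: _ => [|j u _ us]; first exact: star0.
  by rewrite starD us (psd_star (Epsd j).1).
have SS : S * S = \sum_j E j * E j.
  rewrite /S mulr_suml; apply: eq_bigr => j _.
  rewrite mulr_sumr (bigD1 j) //= big1 ?addr0 // => k kj.
  by rewrite Eorth // eq_sym.
have : psd ((1 - S) * (1 - S)) by apply: psd_sqr; rewrite starB star1 Ss.
have -> : (1 - S) * (1 - S) = 1 - S - (S - S * S) by ncring.
move=> /trace_le; rewrite [phi (1 - S)]traceB raddfB /=.
rewrite [phi S](trace_sum E) raddf_sum /=.
apply: le_trans; rewrite SS /S -sumrB trace_sum raddf_sum /= (bigD1 i) //= lerDl.
by apply: sumr_ge0 => j _; apply: Re_trace_psd; apply: psd_defect; case: (Epsd j).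
Qed.

End Functional.

Lemma pos_trace_hom (D A : cstarAlgType R) (f : {linear D -> A}) (tau : A -> R[i]) :
  (forall x y, f (x * y) = f x * f y) -> (forall x, f (star x) = star (f x)) ->
  pos_trace tau -> pos_trace (tau \o f).
Proof.
move=> fM fS [tl tp tC]; split=> [k u v|x|x y] /=.
- by rewrite linearP tl.
- by rewrite fM fS.
- by rewrite !fM tC.
Qed.

(** The last clause says that the elements given by property Gamma are almost
projections for every trace; it comes from [trace_defect_le] and the estimate for
the unit. *)
Lemma gamma_elements (D : cstarAlgType R) (G : set D) (e : R) n :
  uniform_property_Gamma D -> finite_set G -> 0 < e -> (0 < n)%N ->
  exists E : 'I_n -> D,
    [/\ forall i, psd (E i) /\ nrm (E i) <= 1,
        forall i j, i != j -> E i * E j = 0,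
        forall i a, G a -> nrm (E i * a - a * E i) < e,
        forall i a phi, G a -> pos_trace phi ->
          nrm (phi (a * E i) - n%:R^-1 * phi a) <= e * complex.Re (phi 1) &
        forall i phi, pos_trace phi ->
          [/\ nrm (phi (E i) - n%:R^-1 * phi 1) <= e * complex.Re (phi 1),
              0 <= complex.Re (phi (E i - E i * E i)) &
              complex.Re (phi (E i - E i * E i)) <= n%:R * e * complex.Re (phi 1)]].
Proof.
move=> gD fG e0 n0.
have fG1 : finite_set (G `|` [set 1]) by rewrite finite_setU; split.
have [E [Epos Eorth EG]] := gD _ e n fG1 e0 n0.
have Epsd i : psd (E i) /\ nrm (E i) <= 1.
  have [pE E1] := Epos i; split; first exact: positive_psd.
  by rewrite -nrm_le rmorph1.
have tr i a phi : (G `|` [set 1]) a -> pos_trace phi ->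
    nrm (phi (a * E i) - n%:R^-1 * phi a) <= e * complex.Re (phi 1).
  move=> Ga tphi; rewrite -(traceZ tphi) -(traceB tphi).
  apply: trace_bound_of_states => //; first exact: ltW.
  move=> sigma ssigma; have tsig := tracial_state_pos_trace ssigma.
  rewrite traceB // traceZ //; apply: ltW; rewrite -lte_fin.
  apply: le_lt_trans (EG i a Ga).2.
  by apply: ereal_sup_ubound; exists sigma.
have tr1 i phi : pos_trace phi ->
    nrm (phi (E i) - n%:R^-1 * phi 1) <= e * complex.Re (phi 1).
  by move=> tphi; have := tr i 1 phi; rewrite mul1r; apply => //; right.
exists E; split=> // [i a Ga|i a phi Ga|i phi tphi].
- by rewrite -nrm_lt; apply: (EG i a _).1; left.
- by apply: tr; left.
split; first exact: tr1.
  by apply: (Re_trace_psd tphi); apply: psd_defect; case: (Epsd i).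
apply: le_trans (trace_defect_le tphi Epsd Eorth i) _.
have nn : n%:R != 0 :> R by rewrite pnatr_eq0 -lt0n.
have sumC (x : R) : \sum_(j < n) x = n%:R * x.
  by rewrite sumr_const card_ord mulr_natl.
have {1}-> : complex.Re (phi 1) = \sum_(j < n) n%:R^-1 * complex.Re (phi 1).
  by rewrite sumC mulrA divff ?mul1r.
rewrite -sumrB -mulrA -sumC.
apply: ler_sum => j _; apply: le_trans (tr1 j phi tphi).
rewrite nrm_distC; apply: le_trans (Re_le_nrm _).
by rewrite raddfB /= natVC ReZ.
Qed.
End Traces.

(** * Elements of small trace *)

Section SmallElement.
Context {R : realType}.

(** When [b] is a unit for [s], [tau (b^2)] bounds the dimension function of
[tau] at [s^2].  Indeed [m = (r s)^* (r s)] satisfies [m = b m b <= |m| b^2], and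
[tau m] is the trace of [(r s) (r s)^*], the element that approximates [c]. *)
Lemma trace_cuntz_le (A : cstarAlgType R) (tau : A -> R[i]) (s b c : A) :
  tracial_state A tau -> star s = s -> star b = b -> b * s = s ->
  nrm c <= 1 -> cuntz_sub c (s * s) ->
  complex.Re (tau c) <= complex.Re (tau (b * b)).
Proof.
move=> stau ss sb bs c1 [r /cvgrPdistC_lt rcvg].
have ttau := tracial_state_pos_trace stau; have tau1 : tau 1 = 1 by case: stau.
have sbs : s * b = s by rewrite -[in RHS]bs -[in LHS]ss -[in LHS]sb -starM bs.
have b0 : 0 <= complex.Re (tau (b * b)).
  exact: (Re_trace_psd ttau (psd_sqr sb)).
rewrite -subr_le0; apply: (@le0_eps _ _ (complex.Re (tau (b * b)) + 2)).
  lra.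
move=> z z0; have : 0 < z%:C by rewrite ltcR.
move=> /rcvg[N _ /(_ N (leqnn N))]; rewrite /= subr0 normr_id nrm_lt.
set d := r N * (s * s) * star (r N) => dz.
pose m := star (r N * s) * (r N * s).
have dE : d = (r N * s) * star (r N * s) by rewrite /d starM ss; ncring.
have td : tau d = tau m by rewrite dE traceC.
have mz : nrm m <= 1 + z.
  rewrite /m nrmC -nrmCV -dE; have := nrm_distD c d 0.
  rewrite !subr0; lra.
have mb : b * m * b = m.
  rewrite /m starM ss; have -> : b * (s * star (r N) * (r N * s)) * b =
    (b * s) * star (r N) * (r N * (s * b)) by ncring.
  by rewrite bs sbs.
have : psd ((1 + z)%:C *: (b * b) - m).
  have -> : (1 + z)%:C *: (b * b) - m = b * ((1 + z)%:C%:A - m) * b.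
    by rewrite mulrBr mulrBl -scalerAr -scalerAl mulr1 mb.
  apply: psd_conj_sa => //; apply: psd_subr_nrm => //.
  exact: psd_star (psd_starM _).
move=> /(trace_le ttau); rewrite trace_Zr // -td => tm.
have := trace_nrm ttau (c - d); rewrite tau1 nrm_distC traceB //= mulr1 => tcd.
have := Re_le_nrm (tau c - tau d); rewrite raddfB /=.
lra.
Qed.

(** Property Gamma gives [E >= 0] of trace about [1 / N] with [E^2] close to [E]
in trace.  Take [s = (2 E - 1)_+] and [b = 1 - (2 E - 1)_-], that is
[b = min (2 E, 1)].  If [s] vanished, then [2 E <= 1], hence [2 E^2 <= E], and the
traces of [E] and [E^2] would not be close.  The bound on [b^2] is Chebyshev's
inequality in the form [b^2 <= 4 E^2 <= 4 E]. *)
Lemma small_support (D : cstarAlgType R) N :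
  uniform_property_Gamma D -> tracial_state D !=set0 -> (0 < N)%N ->
  exists s b : D, [/\ star s = s, s * s != 0, star b = b, b * s = s &
    forall phi, pos_trace phi ->
      complex.Re (phi (b * b)) <= 8 * N%:R^-1 * complex.Re (phi 1)].
Proof.
move=> gD [sigma ssigma] N0.
pose i : R := N%:R^-1.
have N1 : 1 <= N%:R :> R by rewrite ler1n.
have i0 : 0 < i by rewrite invr_gt0 ltr0n.
have i1 : i <= 1 by rewrite invf_le1 // ltr0n.
have Ni : N%:R * i = 1 by rewrite mulfV // pnatr_eq0 -lt0n.
(* The error i^2 / 4 = 1 / (4 N^2) bounds the defect of E by i / 4, which is small
   against the trace i of E. *)
have e0 : 0 < i * i / 4 by rewrite divr_gt0 // mulr_gt0.
have [E0 [Epsd _ _ _ Etr]] :=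
  gamma_elements gD (@finite_set0 D) e0 N0.
move: (Epsd (Ordinal N0)) (Etr (Ordinal N0)); move: (E0 (Ordinal N0)) => E.
move=> [pE E1] {Epsd Etr E0} Etr.
have Es := psd_star pE.
have NE : N%:R * (i * i / 4) = i / 4 by rewrite !mulrA Ni; lra.
have trE phi : pos_trace phi ->
    [/\ 0 <= complex.Re (phi 1),
        complex.Re (phi E) <= (i + i * i / 4) * complex.Re (phi 1),
        (i - i * i / 4) * complex.Re (phi 1) <= complex.Re (phi E),
        0 <= complex.Re (phi (E - E * E)) &
        complex.Re (phi (E - E * E)) <= i / 4 * complex.Re (phi 1)].
  move=> tphi; have [h1 h2 h3] := Etr phi tphi.
  rewrite NE in h3; rewrite natVC -/i in h1; split=> //; first exact: Re_trace_psd psd1.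
    have := Re_le_nrm (phi E - i%:C * phi 1).
    by rewrite raddfB /= ReZ; lra.
  have := Re_le_nrm (i%:C * phi 1 - phi E).
  by rewrite nrm_distC raddfB /= ReZ; lra.
pose v := E + E - 1.
have [p [n [pp pn vE pn0 np0]]] : exists p n : D,
  [/\ psd p, psd n, v = p - n, p * n = 0 & n * p = 0].
  by apply: pos_neg_parts; rewrite /v starB starD star1 Es.
exists p, (1 - n); split.
- exact: psd_star.
- apply/eqP => pp0.
  have p0 : p = 0.
    apply: nrm_eq0; have := nrm_sqr (psd_star pp).
    rewrite pp0 nrm0 => /esym/eqP; rewrite expf_eq0 => /andP[_ /eqP ->] //.
  have tsig := tracial_state_pos_trace ssigma.
  have s1 : sigma 1 = 1 by case: ssigma.
  have [w [/psd_star ws ww _]] := psd_sqrt pE.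
  have nE : n = 1 - (E + E).
    have -> : n = - v by rewrite vE p0; ncring.
    by rewrite /v; ncring.
  have : psd (w * n * w) by exact: psd_conj_sa.
  have -> : w * n * w = (E - E * E) + (E - E * E) - E.
    by rewrite nE -ww; ncring.
  move=> /(Re_trace_psd tsig); rewrite traceB // traceD // raddfB raddfD /=.
  have [_ _] := trE sigma tsig; rewrite s1 /=; nra.
- by rewrite starB star1 psd_star.
- by rewrite mulrBl mul1r np0 subr0.
move=> phi tphi; have [h1 h2 _ h4 _] := trE phi tphi.
have : psd (E + E + E + E - (1 - n) * (1 - n)).
  have -> : E + E + E + E - (1 - n) * (1 - n) =
     (p + p + p * p) + ((E - E * E) + (E - E * E) + ((E - E * E) + (E - E * E))).
    have E2 : E + E = 1 + p - n.
      have -> : E + E = 1 + v by rewrite /v; ncring.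
      by rewrite vE; ncring.
    have E4 : E * E + E * E + (E * E + E * E) = (1 + p - n) * (1 + p - n).
      by rewrite -E2; ncring.
    have -> : (E - E * E) + (E - E * E) + ((E - E * E) + (E - E * E)) =
      E + E + E + E - (E * E + E * E + (E * E + E * E)) by ncring.
    rewrite E4; have -> : (1 + p - n) * (1 + p - n) =
      p + p + p * p - p * n - n * p + (1 - n) * (1 - n) by ncring.
    by rewrite pn0 np0; ncring.
  have pd : psd (E - E * E) by exact: psd_defect.
  by do !apply: psdD => //; exact: psd_sqr (psd_star pp).
move=> /(trace_le tphi); rewrite !traceD // !raddfD /= -/i.
nra.
Qed.

(** The approximation property for the unit of [A] embeds a member [D] of the
class into [A]; the traces of [A] restrict to [D], so the pair of [small_support]
can be transported, and [trace_cuntz_le] applies in [A]. *)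
Lemma WTA_small_trace (Omega : cstarAlgType R -> Prop) (A : cstarAlgType R) (e : R) :
  (forall B : cstarAlgType R, Omega B ->
     tracial_state B !=set0 /\ uniform_property_Gamma B) ->
  WTA Omega A -> 0 < e ->
  exists a : A, [/\ positive a, a <> 0 &
    forall c, nrm c <= 1 -> cuntz_sub c a ->
      forall tau, tracial_state A tau -> complex.Re (tau c) <= e].
Proof.
move=> hOmega [_ wta] e0.
have one_pos : positive (1 : A) by exists 1; rewrite star1 mulr1.
have half0 : 0 < 2^-1 :> R by rewrite invr_gt0.
have one0 : (1 : A) <> 0 by apply/eqP; exact: oner_neq0.
have [p [g [B [_ _ [_ _ [D [f [OD fM fS finj _]]]] _ _]]]] :=
  wta (2^-1) set0 1 half0 (finite_set0 _) one_pos one0.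
have [Dtr DG] := hOmega D OD.
pose N := (Num.truncn (8 / e)).+1.
have Ne : 8 * N%:R^-1 <= e.
  rewrite ler_pdivrMr ?ltr0n // mulrC -ler_pdivrMr //.
  exact/ltW/truncnS_gt.
have [s [b [ss s0 sb bs sbN]]] := small_support DG Dtr (ltn0Sn _ : (0 < N)%N).
exists (f (s * s)); split.
- by apply: psd_positive; apply: psd_hom => //; exact: psd_sqr.
- by move=> fss; move/eqP: s0; apply; apply: finj; rewrite fss linear0.
move=> c c1 ca tau stau.
have ttau := tracial_state_pos_trace stau; have tau1 : tau 1 = 1 by case: stau.
rewrite fM in ca.
have tc : complex.Re (tau c) <= complex.Re (tau (f b * f b)).
  by apply: (trace_cuntz_le stau _ _ _ c1 ca); rewrite -?fS ?ss ?sb // -fM bs.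
apply: le_trans tc _; rewrite -fM.
have := sbN _ (pos_trace_hom fM fS ttau); rewrite /=.
have : complex.Re (tau (f 1)) <= 1.
  have := trace_le ttau (psd_1B_projection (projection_hom1 fM fS)).
  by rewrite tau1.
have : 0 <= complex.Re (tau (f 1)).
  by apply: (Re_trace_psd ttau); exact: psd_hom psd1.
nra.
Qed.

End SmallElement.

(** * Cutting down by a compression *)

Section Compression.
Context {R : realType} {A : cstarAlgType R}.
Implicit Types (x y z a b c e p q g : A).

Lemma psd_projection_sub p g : projection p -> positive g -> positive (1 - g) ->
  p * g = g -> g * p = g -> psd (p - g) /\ psd (1 - (p - g)).
Proof.
move=> pp /positive_psd pg /positive_psd pg' pgl pgr; split.
  have -> : p - g = p * (1 - g) * p.
    by rewrite mulrBr mulrBl mulr1 pp.2 pgl pgr.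
  by apply: psd_conj_sa => //; exact: pp.1.
have -> : 1 - (p - g) = (1 - p) + g by ncring.
by apply: psdD => //; exact: psd_1B_projection.
Qed.

Lemma psd_contraction a : psd a -> psd (1 - a) -> nrm a <= 1.
Proof. by move=> pa p1a; apply: psd_le_nrm => //; rewrite scale1r. Qed.

Lemma nrmM_le x y (s t : R) : nrm x <= s -> nrm y <= t -> nrm (x * y) <= s * t.
Proof.
by move=> xs yt; rewrite (le_trans (nrmM _ _)) // ler_pM ?nrm_ge0.
Qed.

(** The terms on the right of the displayed identity are the errors of the
chain [e q e x = e e q x = e e b = b e e = q x e e = x q e e = x e q e]. *)
Lemma compressed_commutator e q x b (M d : R) :
  nrm e <= 1 -> nrm q <= 1 -> nrm x <= M -> nrm (q * x - b) <= d ->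
  nrm (q * x - x * q) <= d -> nrm (e * q - q * e) <= d ->
  nrm (e * b - b * e) <= d ->
  nrm (e * q * e * x - x * (e * q * e)) <= (2 * M + 5) * d.
Proof.
move=> e1 q1 xM qxb qx eq_ eb.
have ee1 : nrm (e * e) <= 1 by rewrite -[1]mulr1 nrmM_le.
have -> : e * q * e * x - x * (e * q * e) =
  (- (e * (e * q - q * e) * x) + e * e * (q * x - b)) +
  (e * (e * b - b * e) + (e * b - b * e) * e) +
  (- ((q * x - b) * (e * e)) + (q * x - x * q) * (e * e)) -
  x * (e * q - q * e) * e by ncring.
have -> : (2 * M + 5) * d =
  ((1 * d * M + 1 * d) + (1 * d + d * 1) + (d * 1 + d * 1)) + M * d * 1 by ring.
by do ?[assumption | apply: (le_trans (nrmB _ _)) | apply: (le_trans (nrmD _ _))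
  | apply: lerD | rewrite nrmN | apply: nrmM_le].
Qed.

(** The chain is [x e q e = x q e e = q x e e = b e e], then [b e e = b e], where
the error is a multiple of the trace of [e - e^2], then the estimate for [b], and
finally [b = q x] and [q x = x], where the error is a multiple of the trace of
[1 - q]. *)
Lemma compressed_trace e q x b (M d : R) n tau :
  tracial_state A tau -> (0 < n)%N ->
  nrm e <= 1 -> nrm x <= M -> nrm (q * x - b) <= d ->
  nrm b <= M + 1 ->
  nrm (q * x - x * q) <= d -> nrm (e * q - q * e) <= d ->
  psd (e - e * e) -> complex.Re (tau (e - e * e)) <= n%:R * d ->
  psd (1 - q) -> complex.Re (tau (1 - q)) <= d ->
  nrm (tau (b * e) - n%:R^-1 * tau b) <= d ->
  nrm (tau (x * (e * q * e)) - n%:R^-1 * tau x) <=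
    (4 * M + 2 * (M + 1) * n%:R + 7) * d.
Proof.
move=> stau n0 e1 xM qxb bM qx eq_ pe te pq tq tb.
have ttau := tracial_state_pos_trace stau; have tau1 : tau 1 = 1 by case: stau.
have tn z : nrm (tau z) <= 2 * nrm z.
  by have := trace_nrm ttau z; rewrite tau1 mulr1.
have ee1 : nrm (e * e) <= 1 by rewrite -[1]mulr1 nrmM_le.
have M0 : 0 <= M := le_trans (nrm_ge0 _) xM.
have d0 : 0 <= d := le_trans (nrm_ge0 _) qxb.
have i1 : nrm (n%:R^-1 : R[i]) <= 1.
  by rewrite natVC nrm_real ger0_norm ?invr_ge0 // invf_le1 ?ler1n ?ltr0n.
have -> : tau (x * (e * q * e)) - n%:R^-1 * tau x =
  tau (x * (e * q - q * e) * e) - tau ((q * x - x * q) * (e * e)) +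
  tau ((q * x - b) * (e * e)) - tau (b * (e - e * e)) +
  (tau (b * e) - n%:R^-1 * tau b) -
  n%:R^-1 * tau (q * x - b) - n%:R^-1 * tau (x * (1 - q)).
  have -> : x * (e * q * e) = x * (e * q - q * e) * e -
    (q * x - x * q) * (e * e) + (q * x - b) * (e * e) - b * (e - e * e) + b * e.
    by ncring.
  have -> : tau (x * (1 - q)) = tau x - tau (q * x).
    by rewrite mulrBr mulr1 traceB // [tau (x * q)]traceC.
  rewrite [tau (q * x - b)]traceB // traceD // traceB // traceD // traceB //.
  ring.
have t1 : nrm (tau (x * (e * q - q * e) * e)) <= 2 * (M * d * 1).
  by apply: le_trans (tn _) _; rewrite ler_pM2l //; do ?apply: nrmM_le.
have t2 : nrm (tau ((q * x - x * q) * (e * e))) <= 2 * (d * 1).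
  by apply: le_trans (tn _) _; rewrite ler_pM2l //; do ?apply: nrmM_le.
have t3 : nrm (tau ((q * x - b) * (e * e))) <= 2 * (d * 1).
  by apply: le_trans (tn _) _; rewrite ler_pM2l //; do ?apply: nrmM_le.
have t4 : nrm (tau (b * (e - e * e))) <= 2 * (M + 1) * (n%:R * d).
  apply: le_trans (trace_mul_psd ttau _ pe) _.
  by rewrite ler_pM ?mulr_ge0 ?nrm_ge0 ?(Re_trace_psd ttau) ?ler_pM2l.
have t5 : nrm (n%:R^-1 * tau (q * x - b)) <= 1 * (2 * d).
  rewrite nrmcM ler_pM ?nrm_ge0 //; apply: le_trans (tn _) _.
  by rewrite ler_pM2l.
have t6 : nrm (n%:R^-1 * tau (x * (1 - q))) <= 1 * (2 * M * d).
  rewrite nrmcM ler_pM ?nrm_ge0 //; apply: le_trans (trace_mul_psd ttau _ pq) _.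
  by rewrite ler_pM ?mulr_ge0 ?nrm_ge0 ?(Re_trace_psd ttau) ?ler_pM2l.
have -> : (4 * M + 2 * (M + 1) * n%:R + 7) * d =
  2 * (M * d * 1) + 2 * (d * 1) + 2 * (d * 1) + 2 * (M + 1) * (n%:R * d) + d
  + 1 * (2 * d) + 1 * (2 * M * d) by ring.
by do ?[assumption | apply: (le_trans (nrmB _ _)) | apply: (le_trans (nrmD _ _))
  | apply: lerD].
Qed.

Lemma finite_set_nrm_bound (F : set A) : finite_set F ->
  exists2 M : R, 0 <= M & forall x, F x -> nrm x <= M.
Proof.
move=> /finite_seqP[s ->]; exists (\sum_(x <- s) nrm x).
  by apply: sumr_ge0 => x _; exact: nrm_ge0.
move=> x /= xs; rewrite (big_rem x) //= lerDl.
by apply: sumr_ge0 => y _; exact: nrm_ge0.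
Qed.

End Compression.

Theorem theorem3p1 (R : realType) (Omega : cstarAlgType R -> Prop)
  (hOmega : forall B : cstarAlgType R, Omega B ->
     [/\ separable_alg B, tracial_state B !=set0, trace_compact B &
         uniform_property_Gamma B])
  (A : cstarAlgType R)
  (A_simple : simple_alg A)
  (A_infdim : infinite_dimensional A)
  (A_sep : separable_alg A)
  (A_fin : stably_finite A)
  (A_WTA : WTA Omega A) :
  uniform_property_Gamma A.
Proof.
have hO (B : cstarAlgType R) : Omega B ->
    tracial_state B !=set0 /\ uniform_property_Gamma B.
  by move=> /hOmega[].
move=> F e n fF e0 n0.
have [M M0 FM] := finite_set_nrm_bound fF.
have n1 : 1 <= n%:R :> R by rewrite ler1n.
(* K is the constant of compressed_trace, and exceeds that of
   compressed_commutator because n is positive. *)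
pose K := 4 * M + 2 * (M + 1) * n%:R + 7.
have K0 : 0 < K by rewrite /K; nra.
pose d := Num.min 1 (e / (2 * K)).
have d0 : 0 < d by rewrite lt_min ltr01 divr_gt0 // mulr_gt0.
have d1 : d <= 1 by rewrite ge_min lexx.
have dK : K * d < e.
  have : d <= e / (2 * K) by rewrite ge_min lexx orbT.
  rewrite ler_pdivlMr ?mulr_gt0 // => H.
  by rewrite (mulrC K); nra.
have [a [pa a0 asmall]] := WTA_small_trace hO A_WTA d0.
have [p [g [B [pp [pg pg'] [Bsub Bg [D [f [OD fM fS _ fB]]]] Fapp [Fcomm qa _]]]]] :=
  A_WTA.2 d F a d0 fF pa a0.
have [[BD BZ _ _] _ Bp B1] := Bsub.
set q := p - g in Fapp Fcomm qa.
have [pq pq1] : psd q /\ psd (1 - q).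
  by apply: psd_projection_sub => //; case: (B1 g Bg).
have q1 : nrm q <= 1 by exact: psd_contraction.
have [qD fqD] : exists qD, f qD = q.
  have : B q by rewrite /q -scaleN1r; apply: BD => //; exact: BZ.
  by rewrite -fB => -[u _ <-]; exists u.
have lift x : exists u, F x -> nrm (q * x - f u) < d.
  have [Fx|nFx] := pselect (F x); last by exists 0.
  have [y + qy] := (Fapp x Fx).1; rewrite -fB => -[u _ uy].
  by exists u; rewrite -nrm_lt uy.
have [beta betaP] := choice lift.
have fG : finite_set ([set qD] `|` (beta @` F)).
  by rewrite finite_setU; split=> //; exact: finite_image.
have [E [Epsd Eorth Ecomm Etr Edef]] := gamma_elements (hO D OD).2 fG d0 n0.
have fle := nrm_hom fM fS.
have fE1 i : nrm (f (E i)) <= 1 by apply: le_trans (fle _) (Epsd i).2.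
have pfE i : psd (f (E i)) by apply: psd_hom => //; case: (Epsd i).
have fEq i : nrm (f (E i) * q - q * f (E i)) <= d.
  rewrite -fqD -!fM -linearB; apply: le_trans (fle _) _; apply/ltW/Ecomm.
  by left.
have fEb i x : F x -> nrm (f (E i) * f (beta x) - f (beta x) * f (E i)) <= d.
  move=> Fx; rewrite -!fM -linearB; apply: le_trans (fle _) _; apply/ltW/Ecomm.
  by right; exists x.
have qx x : F x -> nrm (q * x - x * q) <= d.
  by move=> /Fcomm; rewrite nrm_lt => /ltW.
exists (fun i => f (E i) * q * f (E i)); split.
- move=> i; split.
    by apply: psd_positive; apply: psd_conj_sa => //; exact: psd_star.
  rewrite -(rmorph1 (real_complex R)) nrm_le.
  by rewrite -[leRHS](mulr1 1) -[X in X * 1](mulr1 1) !nrmM_le.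
- move=> i j ij.
  have -> : f (E i) * q * f (E i) * (f (E j) * q * f (E j)) =
    f (E i) * q * (f (E i) * f (E j)) * (q * f (E j)) by ncring.
  by rewrite -fM Eorth // linear0 mulr0 mul0r.
move=> i x Fx; split.
  rewrite nrm_lt; apply: le_lt_trans dK.
  apply: le_trans (compressed_commutator (fE1 i) q1 (FM x Fx) (ltW (betaP x Fx))
    (qx x Fx) (fEq i) (fEb i x Fx)) _.
  by apply: ler_wpM2r; [exact: ltW|rewrite /K; nra].
apply: le_lt_trans (_ : (K * d)%:E < e%:E)%E; last by rewrite lte_fin.
apply: ge_ereal_sup => _ [tau stau <-]; rewrite lee_fin.
have ttau := tracial_state_pos_trace stau; have tau1 : tau 1 = 1 by case: stau.
have tf := pos_trace_hom fM fS ttau.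
have tf1 : complex.Re (tau (f 1)) <= 1.
  have := trace_le ttau (psd_1B_projection (projection_hom1 fM fS)).
  by rewrite tau1.
have df1 : d * complex.Re (tau (f 1)) <= d by nra.
have pdef : psd (f (E i) - f (E i) * f (E i)) by apply: psd_defect.
apply: (@compressed_trace _ _ _ _ _ (f (beta x)) _ _ _ _ stau n0 (fE1 i) (FM x Fx)
  (ltW (betaP x Fx)) _ (qx x Fx) (fEq i) pdef _ pq1).
- have := betaP x Fx; rewrite nrm_distC => H.
  have := nrm_distD (q * x) (f (beta x)) 0; rewrite !subr0.
  have : nrm (q * x) <= 1 * M by apply: nrmM_le => //; exact: FM.
  lra.
- have [_ _] := Edef i _ tf; rewrite /= linearB fM.
  have : n%:R * (d * complex.Re (tau (f 1))) <= n%:R * d by rewrite ler_wpM2l.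
  by rewrite mulrA; lra.
- apply: asmall qa _ stau; apply: psd_contraction pq1 _.
  by have -> : 1 - (1 - q) = q by ncring.
- have := Etr i (beta x) _ _ tf; rewrite /= fM.
  by move=> H; apply: le_trans (H _) df1; right; exists x.
Qed.
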